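(* Let $\mathcal{I}$ be a Galvin ideal on $\omega$. Then, for every $A\in\mathcal{I}^+$ and every coloring $\pi:[A]^2\to 2$, there exists $B\in\mathcal{I}^+$ with $B\subseteq A$ such that $B$ is homogeneous for $\pi$ (i.e. $\pi$ is constant on $[B]^2$).
   Context: An ideal on $\omega$ is a family $\mathcal{I}\subseteq\wp(\omega)$ containing all finite sets, with $\omega\notin\mathcal{I}$, closed under subsets and finite unions. $\mathcal{I}^+$ is the family of infinite subsets of $\omega$ not in $\mathcal{I}$. $[X]^{\omega}$, $[X]^{<\omega}$ and $[X]^2$ denote the families of infinite, finite, and two-element subsets of $X$. For finite $s\subseteq\omega$ and infinite $C\subseteq\omega$, $s\sqsubset C$ means that $s$ is an initial segment of $C$ in its increasing enumeration. For $\mathcal{F}\subseteq[\omega]^{<\omega}$, $\mathrm{hom}(\mathcal{F})$ is the collection of all $B\in[\omega]^\omega$ such that either (I) for every $C\in[B]^\omega$ there is $s\in\mathcal{F}$ with $s\sqsubset C$, or (II) $[B]^{<\omega}\cap\mathcal{F}=\emptyset$. $\mathcal{I}$ is Galvin if for every $\mathcal{F}\subseteq[\omega]^{<\omega}$ and every $A\in\mathcal{I}^+$ there is $B\in\mathcal{I}^+$, $B\subseteq A$, with $B\in\mathrm{hom}(\mathcal{F})$. *)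

(* Defs.v *)
From mathcomp Require Import all_boot finmap.
From mathcomp Require Import boolp classical_sets functions cardinality.

Set Implicit Arguments.
Unset Strict Implicit.
Unset Printing Implicit Defensive.

Local Open Scope classical_set_scope.

(* Elements of [omega]^{<omega} are represented as s : {fset nat}, and [set` s]
   is the corresponding subset of nat. *)

Definition infinite_subsets (X : set nat) : set (set nat) :=
  [set C | infinite_set C /\ C `<=` X].

Definition finite_subsets (X : set nat) : set {fset nat} :=
  [set s | [set` s] `<=` X].

Definition pairs (X : set nat) : set {fset nat} :=
  [set s | #|` s|%fset = 2 /\ [set` s] `<=` X].

(* Binary unions suffice for closure under finite unions, since the empty
   union is a finite set. *)
Record is_ideal (I : set (set nat)) : Prop := IsIdeal {
  ideal_finite : forall X, finite_set X -> I X;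
  ideal_proper : ~ I setT;
  ideal_subset : forall X Y, Y `<=` X -> I X -> I Y;
  ideal_union : forall X Y, I X -> I Y -> I (X `|` Y)
}.

Definition positive (I : set (set nat)) : set (set nat) :=
  [set X | infinite_set X /\ ~ I X].

Definition initial_segment (s : {fset nat}) (C : set nat) : Prop :=
  [set` s] `<=` C /\
  forall m n, m \in s -> C n -> n <= m -> n \in s.

Definition hom (F : set {fset nat}) : set (set nat) :=
  [set B | infinite_set B /\
    ((forall C, infinite_subsets B C -> exists2 s, F s & initial_segment s C)
     \/ finite_subsets B `&` F = set0)].

Definition galvin (I : set (set nat)) : Prop :=
  forall (F : set {fset nat}) (A : set nat), positive I A ->
    exists B, [/\ positive I B, B `<=` A & hom F B].

(* A colouring of [A]^2 is given by a total map on {fset nat}; only its values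
   on pairs A are ever used, for B `<=` A. *)
Definition homogeneous (pi : {fset nat} -> bool) (B : set nat) : Prop :=
  exists c : bool, forall p, pairs B p -> pi p = c.

(* Main.v *)
Require Import Defs.
From mathcomp Require Import all_boot finmap.
From mathcomp Require Import boolp classical_sets functions cardinality.

Local Open Scope classical_set_scope.

(** The colouring is encoded by the family [F] of all two-element sets of colour
    [true]; the Galvin property yields a positive [B] in [hom F].  If [B]
    has no finite subset in [F], then all pairs of [B] have colour [false].
    Otherwise every infinite subset of [B] starts with a pair of colour [true],
    and each pair [p] of [B] is the start of an infinite subset of [B]
    ([initial_segment_extension]).  A set has only one initial segment of each
    size ([initial_segment_inj]), so [p] itself has colour [true]. *)

(** Two initial segments of [C] are comparable: if [x] lies in [s] but not in
    [t], then all of [t] lies below [x], hence in [s]. *)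
Lemma initial_segment_inj {C : set nat} {s t : {fset nat}} :
  initial_segment s C -> initial_segment t C -> #|` s|%fset = #|` t|%fset ->
  s = t.
Proof.
move=> [sC sI] [tC tI] st.
have [sub_st|/fsubsetPn[x xs xt]] := boolP (s `<=` t)%fset.
  by apply/eqP; rewrite eqEfcard sub_st st leqnn.
suff sub_ts : (t `<=` s)%fset.
  by apply/eqP; rewrite eq_sym eqEfcard sub_ts st leqnn.
apply/fsubsetP => m mt; case: (leqP m x) => [mx|/ltnW xm].
  exact: sI xs (tC m mt) mx.
by rewrite (tI m x mt (sC x xs) xm) in xt.
Qed.

(** The witness keeps, besides [p], only the elements of [B] above [max p]. *)
Lemma initial_segment_extension {B : set nat} {p : {fset nat}} :
  infinite_set B -> [set` p] `<=` B ->
  exists2 C, infinite_subsets B C & initial_segment p C.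
Proof.
move=> Binf pB; pose k := \max_(m <- p) m.
exists ([set` p] `|` (B `\` `I_k.+1)).
  split; last by move=> n [/pB //|[]].
  have tail_inf := infinite_setD Binf (finite_II k.+1).
  apply: contra_not tail_inf; apply: sub_finite_set; exact: subsetUr.
split; first exact: subsetUl.
move=> m n mp [//|[_ /= nk]] nm; case: nk.
by rewrite ltnS (leq_trans nm) //; exact: leq_bigmax_seq.
Qed.

Theorem proposition4p4 (I : set (set nat)) (hI : is_ideal I) (hG : galvin I)
    (A : set nat) (hA : positive I A) (pi : {fset nat} -> bool) :
  exists B : set nat, [/\ positive I B, B `<=` A & homogeneous pi B].
Proof.
pose F : set {fset nat} := [set s | #|` s|%fset = 2 /\ pi s].
have [B [Bpos BA [Binf homB]]] := hG F A hA.
exists B; split=> //; case: homB => [start|noF].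
- exists true => p [p2 pB].
  have [C CB pC] := initial_segment_extension Binf pB.
  have [s [s2 pis] sC] := start C CB.
  by rewrite (initial_segment_inj pC sC) // p2 s2.
- exists false => p [p2 pB]; apply/negbTE/negP => pip.
  suff : (finite_subsets B `&` F) p by rewrite noF.
  by [].
Qed.
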